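(* Let $\alpha=(\alpha_1,\ldots,\alpha_n)$ be a composition, $\sigma\in S_n$, and $i\in\{1,\ldots,n-1\}$ with $\alpha_i=\alpha_{i+1}$. Then the pair of maps $P_i:\mathrm{NAF}(\alpha,\sigma)\times\mathrm{NAF}(\alpha,\sigma s_i)\to\mathbb{Q}(q,t)$ and $P_i:\mathrm{NAF}(\alpha,\sigma s_i)\times\mathrm{NAF}(\alpha,\sigma)\to\mathbb{Q}(q,t)$ is a probabilistic bijection between $\mathrm{NAF}(\alpha,\sigma)$ and $\mathrm{NAF}(\alpha,\sigma s_i)$ with respect to the weight $\mathrm{wt}_{q,t}$; that is, for all $T\in\mathrm{NAF}(\alpha,\sigma)$ and $U\in\mathrm{NAF}(\alpha,\sigma s_i)$, $$\mathrm{wt}_{q,t}(U)P_i(U,T)=\mathrm{wt}_{q,t}(T)P_i(T,U).$$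
   Context: Permutations are in one-line notation; $\sigma s_i$ is $\sigma$ with the entries in positions $i,i+1$ exchanged (so $(\sigma s_i)s_i=\sigma$). A composition is a sequence of nonnegative integers. The skyline diagram is $\mathrm{dg}(\alpha)=\{(j,r):1\le j\le n,\ 1\le r\le\alpha_j\}$ ($j$ = column, $r$ = row) and the augmented diagram is $\mathrm{adg}(\alpha)=\mathrm{dg}(\alpha)\cup\{(j,0):1\le j\le n\}$ (row $0$ is the basement). For $u=(j,r)\in\mathrm{dg}(\alpha)$: the box south of $u$ is $\mathrm{south}(u)=(j,r-1)$; $\mathrm{leg}(u)=\alpha_j-r$; the left arm set is $\{(j',r-1)\in\mathrm{adg}(\alpha):j'<j,\ \alpha_{j'}<\alpha_j\}$, the right arm set is $\{(j',r)\in\mathrm{dg}(\alpha):j'>j,\ \alpha_{j'}\le\alpha_j\}$, $\mathrm{Arm}(u)$ is their union and $\mathrm{arm}(u)=|\mathrm{Arm}(u)|$. Two boxes of $\mathrm{adg}(\alpha)$ attack each other if they are in the same row, or in consecutive rows with the box in the higher row strictly to the right of the box in the lower row. A filling of shape $\alpha$ and basement $\tau\in S_n$ is a map $T:\mathrm{adg}(\alpha)\to\{1,\ldots,n\}$ with $T(j,0)=\tau_j$; $\mathrm{F}(\alpha,\tau)$ is the set of these, and $\mathrm{NAF}(\alpha,\tau)$ the subset of non-attacking ones (attacking boxes have distinct entries). For integers $a,b$ let $\chi(a,b)=1$ if $a>b$ and $0$ otherwise, and $\chi(a,b,c)=\chi(a,b)+\chi(b,c)-\chi(a,c)$. For $T\in\mathrm{NAF}(\alpha,\tau)$: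 a descent is $u\in\mathrm{dg}(\alpha)$ with $T(u)>T(\mathrm{south}(u))$, and $\mathrm{maj}(T)=\sum_{u\text{ descent}}(\mathrm{leg}(u)+1)$; a triple is $(u,v,w)$ with $u\in\mathrm{dg}(\alpha)$, $w=\mathrm{south}(u)$, $v\in\mathrm{Arm}(u)$; it is an inversion triple if $\chi(T(u),T(v),T(w))=1$ and a coinversion triple otherwise; $\mathrm{coinv}(T)$ is the number of coinversion triples; and $\mathrm{wt}_{q,t}(T)=q^{\mathrm{maj}(T)}t^{\mathrm{coinv}(T)}\prod_{u\in\mathrm{dg}(\alpha),\,T(u)\ne T(\mathrm{south}(u))}\frac{1-t}{1-q^{1+\mathrm{leg}(u)}t^{1+\mathrm{arm}(u)}}$. Fix $i$ with $\alpha_i=\alpha_{i+1}$. For a filling $T$ and $0\le r\le\alpha_i$, $\mathrm{swap}_r(T)$ exchanges the entries of boxes $(i,r)$ and $(i+1,r)$, and $\Omega_{0,h}=\mathrm{swap}_h\circ\cdots\circ\mathrm{swap}_0$. For $T\in\mathrm{NAF}(\alpha,\tau)$ (any $\tau$) and $0\le r\le\alpha_i-1$, let $a=T(i,r)$, $b=T(i+1,r)$, $c=T(i,r+1)$, $d=T(i+1,r+1)$, $A=\mathrm{arm}(i+1,r+1)$, $\ell=\mathrm{leg}(i+1,r+1)$, and define $\rho_r(T)\in\mathbb{Q}(q,t)$: if $a,b,c,d$ are distinct, $\rho_r(T)=0$ when $\chi(c,d,a)=\chi(c,d,b)$ and $\rho_r(T)=1$ when $\chi(c,d,a)=\chi(d,c,b)$;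 if exactly three of them are distinct, then $\rho_r(T)=0$ if $b=c$, $\rho_r(T)=1$ if $b=d$, and $\rho_r(T)=t^{1-\chi(d,a,b)}\frac{1-q^{\ell+1}t^{A+1}}{1-q^{\ell+1}t^{A+2}}$ if $a=c$; if $a=c$ and $b=d$, $\rho_r(T)=1$. Also set $\rho_{\alpha_i}(T)=0$. For $T\in\mathrm{NAF}(\alpha,\tau)$ and a filling $U$ of shape $\alpha$ and basement $\tau s_i$, $P_i(T,U)=\left(\prod_{r=0}^{h-1}\rho_r(T)\right)(1-\rho_h(T))$ if $U=\Omega_{0,h}(T)$ for some $h\in\{0,\ldots,\alpha_i\}$, and $P_i(T,U)=0$ otherwise. This is applied both with $\tau=\sigma$ and with $\tau=\sigma s_i$. A probabilistic bijection between $(\mathbf{T},\mathrm{wt})$ and $(\mathbf{U},\mathrm{wt})$ is a pair $P_{\mathbf{T}}:\mathbf{T}\times\mathbf{U}\to A$, $P_{\mathbf{U}}:\mathbf{U}\times\mathbf{T}\to A$ with $\sum_{U}P_{\mathbf{T}}(T,U)=1$, $\sum_TP_{\mathbf{U}}(U,T)=1$, and $\mathrm{wt}(T)P_{\mathbf{T}}(T,U)=\mathrm{wt}(U)P_{\mathbf{U}}(U,T)$ for all $T,U$. *)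

(* Defs.v *)
From HB Require Import structures.
From mathcomp Require Import all_boot all_order all_algebra all_fingroup.
From mathcomp Require Import fraction.
Set Implicit Arguments. Unset Strict Implicit. Unset Printing Implicit Defensive.
Import Order.TTheory GRing.Theory Num.Theory.
Local Open Scope ring_scope.

Definition Kqt := {fraction {poly {poly rat}}}.
Definition qv : Kqt := @FracField.tofrac {poly {poly rat}} 'X.
Definition tv : Kqt := @FracField.tofrac {poly {poly rat}} (('X : {poly rat})%:P).

Definition chi (a b : nat) : int := if (b < a)%N then 1 else 0.
Definition chi3 (a b c : nat) : int := chi a b + chi b c - chi a c.

Section Fillings.
Variables (n : nat) (alpha : 'I_n -> nat).

(* Columns are 0-indexed ('I_n), rows are 0..alpha j (row 0 = basement). *)
Definition M := (\max_(j < n) alpha j)%N.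
Definition adgP (x : 'I_n * 'I_M.+1) : bool := (x.2 <= alpha x.1)%N.
Definition box := {x : 'I_n * 'I_M.+1 | adgP x}.
(* fillings: maps adg(alpha) -> {1..n}, entries encoded as 'I_n (k <-> k+1) *)
Definition filling := {ffun box -> 'I_n}.

(* entry of box (j,r), as a number in {1..n}; 0 if (j,r) is not a box *)
Definition ent (T : filling) (j : 'I_n) (r : nat) : nat :=
  if insub r : option 'I_M.+1 is Some r' then
    if insub (j, r') : option box is Some b then (val (T b)).+1 else 0%N
  else 0%N.

Definition has_basement (tau : 'S_n) (T : filling) : bool :=
  [forall j : 'I_n, ent T j 0 == (tau j).+1].

Definition attack (b1 b2 : box) : bool :=
  let j1 := (val b1).1 in let r1 := val (val b1).2 in
  let j2 := (val b2).1 in let r2 := val (val b2).2 in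
  (b1 != b2) &&
  [|| r1 == r2,
      (r2 == r1.+1) && (j1 < j2)%N
    | (r1 == r2.+1) && (j2 < j1)%N].

Definition nonattacking (T : filling) : bool :=
  [forall b1, forall b2, attack b1 b2 ==> (T b1 != T b2)].

Definition NAF (tau : 'S_n) : {set filling} :=
  [set T | has_basement tau T && nonattacking T].

Definition leg (j : 'I_n) (r : nat) : nat := (alpha j - r)%N.

(* left and right arm sets of u = (j,r), given by their columns *)
Definition left_arm (j : 'I_n) (r : nat) (j' : 'I_n) : bool :=
  [&& (j' < j)%N, (alpha j' < alpha j)%N & (r.-1 <= alpha j')%N].
Definition right_arm (j : 'I_n) (r : nat) (j' : 'I_n) : bool :=
  [&& (j < j')%N, (alpha j' <= alpha j)%N & (r <= alpha j')%N].
Definition arm (j : 'I_n) (r : nat) : nat :=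
  (#|[pred j' | left_arm j r j']| + #|[pred j' | right_arm j r j']|)%N.

Definition maj (T : filling) : nat :=
  (\sum_(j < n) \sum_(1 <= r < (alpha j).+1)
     (if (ent T j r.-1 < ent T j r)%N then (leg j r).+1 else 0))%N.

Definition coinv (T : filling) : nat :=
  (\sum_(j < n) \sum_(1 <= r < (alpha j).+1)
     (#|[pred j' | left_arm j r j' &&
           (chi3 (ent T j r) (ent T j' r.-1) (ent T j r.-1) != 1)]|
    + #|[pred j' | right_arm j r j' &&
           (chi3 (ent T j r) (ent T j' r) (ent T j r.-1) != 1)]|))%N.

Definition wt (T : filling) : Kqt :=
  qv ^+ maj T * tv ^+ coinv T *
  \prod_(j < n) \prod_(1 <= r < (alpha j).+1 | ent T j r != ent T j r.-1)
     ((1 - tv) / (1 - qv ^+ (leg j r).+1 * tv ^+ (arm j r).+1)).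

(* The swap of columns i and i1 = i+1 *)
Variables (i i1 : 'I_n).

Definition partner (b : box) : box :=
  odflt b (insub (tperm i i1 (val b).1, (val b).2)).

(* Omega_{0,h} = swap_h o ... o swap_0 *)
Definition Omega (h : nat) (T : filling) : filling :=
  [ffun b => if (val (val b).2 <= h)%N then T (partner b) else T b].

Definition rho (T : filling) (r : nat) : Kqt :=
  if (r < alpha i)%N then
    let a := ent T i r in let b := ent T i1 r in
    let c := ent T i r.+1 in let d := ent T i1 r.+1 in
    let A := arm i1 r.+1 in let l := leg i1 r.+1 in
    let nd := size (undup [:: a; b; c; d]) in
    if nd == 4%N then
      (if chi3 c d a == chi3 c d b then 0
       else if chi3 c d a == chi3 d c b then 1 else 0)
    else if nd == 3%N then
      (if b == c then 0
       else if b == d then 1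
       else if a == c then
         tv ^ (1 - chi3 d a b) * ((1 - qv ^+ l.+1 * tv ^+ A.+1)
                                   / (1 - qv ^+ l.+1 * tv ^+ A.+2))
       else 0)
    else if (a == c) && (b == d) then 1
    else 0
  else 0.

Definition Pi (T U : filling) : Kqt :=
  if [pick h : 'I_(alpha i).+1 | U == Omega h T] is Some h then
    (\prod_(r < h) rho T r) * (1 - rho T h)
  else 0.

End Fillings.

Definition prob_bij (X : finType) (TT UU : {set X}) (wtT wtU : X -> Kqt)
  (PT PU : X -> X -> Kqt) : Prop :=
  [/\ forall T, T \in TT -> \sum_(U in UU) PT T U = 1,
      forall U, U \in UU -> \sum_(T in TT) PU U T = 1
    & forall T U, T \in TT -> U \in UU -> wtT T * PT T U = wtU U * PU U T].

(* Main.v *)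
Require Import Defs.
From HB Require Import structures.
From mathcomp Require Import all_boot all_order all_algebra all_fingroup.
From mathcomp Require Import fraction ring zify.

(* Up to a factor that is symmetric in columns i, i+1 (hence unchanged when rows
   of these columns are swapped), wt(T) is a product over consecutive rows r, r+1
   of a local weight depending only on a = T(i,r), b = T(i+1,r), c = T(i,r+1),
   d = T(i+1,r+1).  Since chi3 takes values in {0,1}, coinv is a sum of 1 - chi3;
   expanding chi3 shows that each arm column contributes a symmetric term plus the
   number of descents among (a,c), (b,d), so that with x = q^(leg+1) t^arm the
   local weight is
     x^(#descents) t^(1 - chi3(c,d,a)) ((1-t)/(1-x t^2))^[c<>a] ((1-t)/(1-x t))^[d<>b].
   If U = Omega_h T then T = Omega_h U, and detailed balance splits into one
   identity for each row below h (both rows swapped) and one for the row h (only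
   the lower row swapped).  The probabilities sum to 1 by telescoping; a swap that
   creates an attack has probability 0, because rho = 0 if b = c and rho = 1
   if b = d. *)

(** * Local identities for two consecutive rows of columns i, i+1 *)

Section Local.
Set Implicit Arguments. Unset Strict Implicit. Unset Printing Implicit Defensive.
Import Order.TTheory GRing.Theory Num.Theory.
Local Open Scope ring_scope.

Lemma chi_flip a b : a != b -> chi b a = 1 - chi a b.
Proof. by rewrite /chi; case: ltngtP. Qed.

Lemma chi_irr a : chi a a = 0.
Proof. by rewrite /chi ltnn. Qed.

Lemma chi3_01 a b c : chi3 a b c = 0 \/ chi3 a b c = 1.
Proof.
rewrite /chi3 /chi; case: (ltnP b a); case: (ltnP c b); case: (ltnP c a);
  rewrite ?addr0 ?subr0 ?add0r ?addrN ?addrK; by [left|right|lia].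
Qed.

Lemma chi3_neq1 a b c : (chi3 a b c != 1)%:Z = 1 - chi3 a b c.
Proof. by case: (chi3_01 a b c) => ->. Qed.

Variable F : fieldType.
Implicit Types (x t : F) (a b c d : nat).

(* Entries a b (lower row) and c d (upper row) of columns i, i+1. *)
Definition row_wt x t a b c d : F :=
  x ^+ ((a < c) + (b < d))%N * t ^+ (chi3 c d a != 1%R) *
  ((if c != a then (1 - t) / (1 - x * t ^+ 2) else 1) *
   (if d != b then (1 - t) / (1 - x * t) else 1)).

Definition row_rho x t a b c d : F :=
  let nd := size (undup [:: a; b; c; d]) in
  if nd == 4%N then
    (if chi3 c d a == chi3 c d b then 0
     else if chi3 c d a == chi3 d c b then 1 else 0)
  else if nd == 3%N then
    (if b == c then 0
     else if b == d then 1
     else if a == c then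
       t ^ (1 - chi3 d a b) * ((1 - x * t) / (1 - x * t ^+ 2))
     else 0)
  else if (a == c) && (b == d) then 1
  else 0.

(** Exchanging c and d turns [chi3] into 1 - [chi3], so the two tests in [row_rho] are complementary
    and the last default is never reached. *)
Lemma row_rho_distinct x t a b c d : uniq [:: a; b; c; d] ->
  row_rho x t a b c d = (chi3 c d a != chi3 c d b)%:R.
Proof.
move=> u; rewrite /row_rho undup_id //=.
have cd : c != d by move: u; rewrite /= !inE; case: (c == d); rewrite // !andbF.
have -> : chi3 d c b = 1 - chi3 c d b by rewrite /chi3 (chi_flip cd); ring.
by case: (chi3_01 c d a) => ->; case: (chi3_01 c d b) => ->.
Qed.

Lemma row_rho_bc x t a b d : a != b -> b != d -> a != d ->
  row_rho x t a b b d = 0.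
Proof.
move=> /negbTE ab /negbTE bd /negbTE ad.
by rewrite /row_rho /= !inE !eqxx ab bd ad /= ?ab ?bd ?eqxx.
Qed.

(** The case a = c, with only two distinct entries, is included: that branch of [row_rho] also gives
    1. *)
Lemma row_rho_bd x t a b c : a != b -> b != c ->
  row_rho x t a b c b = 1.
Proof.
move=> /negbTE ab /negbTE bc.
rewrite /row_rho /= !inE !eqxx ab bc (eq_sym c b) bc /=.
by case: (a == c).
Qed.

Lemma row_rho_ac x t a b d : a != b -> b != d -> a != d ->
  row_rho x t a b a d = t ^+ (chi3 d a b != 1%R) * ((1 - x * t) / (1 - x * t ^+ 2)).
Proof.
move=> /negbTE ab /negbTE bd /negbTE ad.
rewrite /row_rho /= !inE !eqxx ab bd ad (eq_sym b a) ab /= ?bd ?eqxx /=.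
by rewrite -chi3_neq1.
Qed.

Lemma row_swap_both x t a b c d :
    1 - x * t ^+ 2 != 0 -> 1 - x * t != 0 ->
    a != b -> c != d -> a != d -> b != c ->
  row_wt x t a b c d * row_rho x t a b c d =
  row_wt x t b a d c * row_rho x t b a d c.
Proof.
move=> nz2 nz1 ab cd ad bc.
(* Exchanging the columns swaps the two sides, so b = d may be assumed to occur only together with a
   = c. *)
wlog ac_bd : a b c d ab cd ad bc / (b == d) ==> (a == c).
  move=> W; have [ac|ac] := boolP ((b == d) ==> (a == c)); first exact: W.
  move: ac; rewrite negb_imply => /andP[bd ac].
  by symmetry; apply: W; rewrite ?bd ?implybT // eq_sym.
have ba : b != a by rewrite eq_sym.
have da : d != a by rewrite eq_sym.
have [/eqP bd|bd] := boolP (b == d).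
  move: ac_bd; rewrite bd eqxx => /= /eqP ac; subst c d.
  rewrite !row_rho_bd // /row_wt !eqxx /=.
  by rewrite /chi3 !chi_irr !subr0 (chi_flip ab) !ltnn /=;
    congr (_ * _ ^+ _ * _ * _); congr (nat_of_bool (~~ _)); rewrite addrC.
have [/eqP ac|ac] := boolP (a == c); last first.
  rewrite !row_rho_distinct; last 2 first.
  - by rewrite /= !inE !negb_or (eq_sym b a) (eq_sym d c) ab ac ad bc bd cd.
  - by rewrite /= !inE !negb_or ab ac ad bc bd cd.
  rewrite /row_wt !(eq_sym d) !(eq_sym c) (negbTE ac) (negbTE bd) /=.
  rewrite (addnC (a < c)%N).
  have E1 : chi3 d c b = 1 - chi3 c d b by rewrite /chi3 (chi_flip cd); ring.
  have E2 : chi3 d c a = 1 - chi3 c d a by rewrite /chi3 (chi_flip cd); ring.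
  rewrite E1 E2.
  (* Either both values of rho vanish, or [chi3 d c b] equals [chi3 c d a] and the powers of t
     agree. *)
  by case: (chi3_01 c d a) => ->; case: (chi3_01 c d b) => ->; rewrite /= ?mulr0.
subst c; rewrite row_rho_ac // row_rho_bd // /row_wt !eqxx /= (eq_sym d b) bd.
(* Since [chi3 a d a] is 1, the left weight has no power of t; rho supplies it and trades the
   denominator 1 - x t for 1 - x t^2. *)
rewrite [chi3 a d a]/chi3 chi_irr subr0 (chi_flip ad) !ltnn.
have -> : chi a d + (1 - chi a d) = 1 by ring.
rewrite eqxx /= addnC; field.
by rewrite nz1 nz2.
Qed.

Lemma row_swap_bottom x t a b c d :
    1 - x * t ^+ 2 != 0 -> 1 - x * t != 0 ->
    a != b -> c != d -> a != d -> b != d ->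
  row_wt x t a b c d * (1 - row_rho x t a b c d) =
  row_wt x t b a c d * (1 - row_rho x t b a c d).
Proof.
move=> nz2 nz1 ab cd ad bd.
wlog ac_bc : a b ab ad bd / (a == c) ==> (b == c).
  move=> W; have [ac|ac] := boolP ((a == c) ==> (b == c)); first exact: W.
  move: ac; rewrite negb_imply => /andP[ac bc].
  by symmetry; apply: W; rewrite ?ac ?implybT // eq_sym.
have ba : b != a by rewrite eq_sym.
have [/eqP bc|bc] := boolP (b == c); last first.
  move: ac_bc; rewrite (negbTE bc) implybF => ac.
  rewrite !row_rho_distinct; last 2 first.
  - by rewrite /= !inE !negb_or (eq_sym b a) ab ac ad bc bd cd.
  - by rewrite /= !inE !negb_or ab ac ad bc bd cd.
  rewrite [chi3 c d b == _]eq_sym.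
  (* If the [chi3] values differ, rho is 1 on both sides. If they agree, rho is 0, and their
     equality says that swapping a and b preserves the number of descents. *)
  case: eqP => [E|_]; last by rewrite subrr !mulr0.
  congr (_ * _); rewrite /row_wt !(eq_sym d) !(eq_sym c) (negbTE ac) (negbTE bc)
    (negbTE ad) (negbTE bd) /= E.
  congr (_ ^+ _ * _ * _); move: E; rewrite /chi3 /chi.
  by case: (a < c)%N; case: (b < d)%N; case: (b < c)%N; case: (a < d)%N; case: (d < c)%N.
subst c; rewrite row_rho_bc // row_rho_ac // /row_wt !eqxx /= (eq_sym b a) ab
  !(eq_sym d) (negbTE bd) (negbTE ad).
rewrite [chi3 b d b]/chi3 chi_irr subr0 (chi_flip bd) !ltnn.
have -> : chi b d + (1 - chi b d) = 1 by ring.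
have E1 : chi3 b d a = 1 - chi3 d b a by rewrite /chi3 (chi_flip bd); ring.
(* On the right, 1 - rho is (1-t)/(1 - x t^2), times x t when [chi3 d b a] is 1; [E1] and [E2] give
   the matching powers of t and x. *)
have E2 : ((a < b) + (b < d))%N = ((a < d) + (chi3 d b a == 1%R))%N.
  rewrite /chi3 /chi.
  by case: (ltnP b d) => ?; case: (ltnP a b) => ?; case: (ltnP a d) => ? //; exfalso; lia.
rewrite E1 E2 exprD.
case: (chi3_01 d b a) => -> /=; field; by rewrite nz1 nz2.
Qed.

Lemma row_wt_monomial q t l m a b c d :
  row_wt (q ^+ l * t ^+ m) t a b c d =
  q ^+ (l * ((a < c) + (b < d)))%N *
  t ^+ (m * ((a < c) + (b < d)) + (chi3 c d a != 1%R))%N *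
  ((if c != a then (1 - t) / (1 - q ^+ l * t ^+ m.+2) else 1) *
   (if d != b then (1 - t) / (1 - q ^+ l * t ^+ m.+1) else 1)).
Proof.
rewrite /row_wt !exprSr expr0 mul1r !mulrA; set D := (_ + _)%N.
by rewrite exprMn -!exprM exprD !mulrA.
Qed.

Lemma row_rho_monomial q t l m a b c d :
  row_rho (q ^+ l * t ^+ m) t a b c d =
  let nd := size (undup [:: a; b; c; d]) in
  if nd == 4%N then
    (if chi3 c d a == chi3 c d b then 0
     else if chi3 c d a == chi3 d c b then 1 else 0)
  else if nd == 3%N then
    (if b == c then 0
     else if b == d then 1
     else if a == c then
       t ^ (1 - chi3 d a b) *
       ((1 - q ^+ l * t ^+ m.+1) / (1 - q ^+ l * t ^+ m.+2))
     else 0)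
  else if (a == c) && (b == d) then 1
  else 0.
Proof. by rewrite /row_rho !exprSr expr0 mul1r !mulrA. Qed.

End Local.

Section Fillings.
Set Implicit Arguments. Unset Strict Implicit. Unset Printing Implicit Defensive.
Import Order.TTheory GRing.Theory Num.Theory.
Local Open Scope ring_scope.

(** * Nonzero denominators and stopping probabilities *)

Lemma one_sub_qt_neq0 k m : 1 - qv ^+ k.+1 * tv ^+ m != 0.
Proof.
rewrite /qv /tv -!tofracXn -tofracM -tofrac1 -tofracB tofrac_eq0.
(* Evaluate at q = 0, q being the outer polynomial variable; its exponent is positive, so 1
   remains. *)
apply/eqP => /(congr1 (fun p => p.[0])).
rewrite !hornerE exprS mul0r mul0r subr0.
by apply/eqP; rewrite oner_eq0.
Qed.

Lemma tv_neq0 : tv != 0.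
Proof. by rewrite tofrac_eq0 polyC_eq0 polyX_eq0. Qed.

(** Telescoping: with p r the probability of continuing past row r, the right side is the complement
    of never stopping. *)
Lemma sum_stop (R : pzRingType) N (p : nat -> R) :
  \sum_(h < N) (\prod_(r < h) p r) * (1 - p h) = 1 - \prod_(r < N) p r.
Proof.
elim: N => [|N IH]; first by rewrite !big_ord0 subrr.
by rewrite big_ord_recr /= IH big_ord_recr /= mulrBr mulr1 addrA subrK.
Qed.

(** Spreads the probability of stopping at h over all rows, to be matched with the weight row by
    row. *)
Definition stop_factor (R : pzRingType) h (p : nat -> R) r : R :=
  if (r < h)%N then p r else if r == h then 1 - p r else 1.

Lemma prod_stop (R : pzRingType) N h (p : nat -> R) : (h <= N)%N -> p N = 0 ->
  (\prod_(r < h) p r) * (1 - p h) = \prod_(r < N) stop_factor h p r.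
Proof.
move=> le_hN pN.
have low : \prod_(r < h) p r = \prod_(0 <= r < h) stop_factor h p r.
  by rewrite big_mkord; apply: eq_bigr => r _; rewrite /stop_factor ltn_ord.
rewrite low -(big_mkord xpredT (stop_factor h p)).
(* For h = N the product has no factor at h; [p N = 0] makes the missing one equal to 1. *)
move: le_hN; rewrite leq_eqVlt => /predU1P[->|lt_hN].
  by rewrite pN subr0 mulr1.
rewrite [RHS](big_cat_nat (n := h)) //=; last exact: ltnW.
have high : \prod_(h.+1 <= r < N) stop_factor h p r = 1.
  rewrite big_nat_cond big1 // => r /andP[/andP[hr _] _].
  by rewrite /stop_factor ltnNge (ltnW hr) /= gtn_eqF.
by rewrite (big_ltn lt_hN) high mulr1 /stop_factor ltnn eqxx.
Qed.

Variables (n : nat) (alpha : 'I_n -> nat).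
Local Notation filling := (filling alpha).
Local Notation box := (box alpha).
Implicit Types (T : filling) (j : 'I_n).

(** * Fillings and attacks in terms of entries *)

Lemma box_of j r : (r <= alpha j)%N ->
  exists b : box, (val b).1 = j /\ val (val b).2 = r.
Proof.
move=> le_r; have ltM : (r < (M alpha).+1)%N by rewrite ltnS (leq_trans le_r) ?leq_bigmax.
have P : adgP (j, Ordinal ltM) by [].
by exists (exist (@adgP n alpha) (j, Ordinal ltM) P).
Qed.

Lemma ent_box T (b : box) : ent T (val b).1 (val (val b).2) = (T b).+1.
Proof.
rewrite /ent valK.
have -> : ((val b).1, (val b).2) = val b by case: (val b).
by rewrite valK.
Qed.

Lemma ent_out T j r : (alpha j < r)%N -> ent T j r = 0%N.
Proof.
move=> lt_r; rewrite /ent; case: insubP => // r' _ Er; case: insubP => // b.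
by rewrite /adgP /= Er leqNgt lt_r.
Qed.

Lemma ent_inj T U : (forall j r, ent T j r = ent U j r) -> T = U.
Proof.
move=> E; apply/ffunP => b; apply: val_inj; apply: succn_inj.
by rewrite -!ent_box E.
Qed.

Lemma nonattackingP T : reflect
  ((forall j j' r, j != j' -> (r <= alpha j)%N -> (r <= alpha j')%N ->
      ent T j r != ent T j' r) /\
   (forall j j' r, (j < j')%N -> (r <= alpha j)%N -> (r < alpha j')%N ->
      ent T j r != ent T j' r.+1))
  (nonattacking T).
Proof.
apply: (iffP forallP) => [NA | [same next] b1].
  split=> [j j' r ne | j j' r lt] /box_of[b1 [Ej1 Er1]] /box_of[b2 [Ej2 Er2]].
    have := forallP (NA b1) b2; rewrite -{1}Er1 -Er2 -Ej1 -Ej2 !ent_box eqSS.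
    move=> /implyP; apply.
    rewrite /attack Er1 Er2 eqxx andbT; apply: contraNneq ne => E.
    by rewrite -Ej1 -Ej2 E.
  have := forallP (NA b1) b2; rewrite -{1}Er1 -Er2 -Ej1 -Ej2 !ent_box eqSS.
  move=> /implyP; apply.
  rewrite /attack Er1 Er2 Ej1 Ej2 lt eqxx orbT andbT.
  by apply/eqP => E; move: Er2; rewrite -E Er1; lia.
apply/forallP => b2; apply/implyP => /andP[ne].
have P1 : (val (val b1).2 <= alpha (val b1).1)%N by case: b1 ne => x.
have P2 : (val (val b2).2 <= alpha (val b2).1)%N by case: b2 ne => x.
suff : ent T (val b1).1 (val (val b1).2) != ent T (val b2).1 (val (val b2).2) ->
       T b1 != T b2.
  move=> S; case/or3P => [/eqP E|/andP[/eqP E lt]|/andP[/eqP E lt]]; apply: S.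
  - rewrite E; apply: same => //; last by rewrite -E.
    apply: contraNneq ne => Ej; apply/eqP; apply: val_inj.
    by move: Ej E; case: (val b1) (val b2) => [j1 r1] [j2 r2] /= -> /val_inj ->.
  - by rewrite E; apply: next => //; rewrite -E.
  - by rewrite eq_sym E; apply: next => //; rewrite -E.
by rewrite !ent_box eqSS.
Qed.

(** * The swaps of two adjacent columns of equal height *)

Variables (i i1 : 'I_n).
Hypotheses (Hi1 : val i1 = (val i).+1) (Halpha : alpha i = alpha i1).
Local Notation s := (tperm i i1).
Local Notation Om := (@Omega n alpha i i1).

Lemma i_neq_i1 : i != i1.
Proof. by apply/eqP => E; move: Hi1; rewrite E; lia. Qed.

Lemma alpha_tperm j : alpha (s j) = alpha j.
Proof. by case: tpermP => [->|->|]. Qed.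

Lemma val_partner (b : box) : val (partner i i1 b) = (s (val b).1, (val b).2).
Proof.
have P : adgP (alpha := alpha) (s (val b).1, (val b).2).
  by rewrite /adgP /= alpha_tperm; exact: valP b.
by rewrite /partner insubT.
Qed.

Lemma ent_Omega h T j r :
  ent (Om h T) j r = ent T (if (r <= h)%N then s j else j) r.
Proof.
(* Outside the diagram both entries are the default 0, as the transposition preserves heights. *)
have [|lt_r] := leqP r (alpha j); last first.
  by rewrite !ent_out //; case: ifP; rewrite ?alpha_tperm.
case/box_of => b [<- <-]; rewrite ent_box ffunE.
case: ifP => _; rewrite -ent_box //.
by rewrite val_partner.
Qed.

Lemma OmegaK h : involutive (Om h).
Proof.
move=> T; apply: ent_inj => j r; rewrite !ent_Omega.
by case: ifP => E; rewrite E ?tpermK.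
Qed.

(** * Arm sets and the two columns *)

Lemma left_arm_tperm j r j' : j != i -> j != i1 ->
  left_arm alpha j r (s j') = left_arm alpha j r j'.
Proof.
move=> ji ji1; rewrite /left_arm alpha_tperm.
have E : nat_of_ord i1 = i.+1 := Hi1.
case: tpermP => // ->; congr (_ && _);
  move: ji ji1; rewrite -!val_eqE /= E; lia.
Qed.

Lemma right_arm_tperm j r j' : j != i -> j != i1 ->
  right_arm alpha j r (s j') = right_arm alpha j r j'.
Proof.
move=> ji ji1; rewrite /right_arm alpha_tperm.
have E : nat_of_ord i1 = i.+1 := Hi1.
case: tpermP => // ->; congr (_ && _);
  move: ji ji1; rewrite -!val_eqE /= E; lia.
Qed.

(** Left arms compare heights strictly, so column i is not in the left arm of column i1. *)
Lemma left_arm_i r j : left_arm alpha i r j = left_arm alpha i1 r j.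
Proof.
rewrite /left_arm Halpha; have E : nat_of_ord i1 = i.+1 := Hi1.
have [->|ji] := eqVneq j i; first by rewrite Halpha !ltnn !andbF.
by congr (_ && _); move: ji; rewrite -val_eqE /= E; lia.
Qed.

(** Right arms allow equal heights, so column i1 is in the right arm of column i. *)
Lemma right_arm_i r j : (r <= alpha i1)%N ->
  right_arm alpha i r j = (j == i1) || right_arm alpha i1 r j.
Proof.
move=> le_r; rewrite /right_arm Halpha; have E : nat_of_ord i1 = i.+1 := Hi1.
have [->|ji] := eqVneq j i1; first by rewrite E ltnSn leqnn le_r.
by congr (_ && _); move: ji; rewrite -val_eqE /= E; lia.
Qed.

Lemma arm_i r : (r <= alpha i1)%N -> arm alpha i r = (arm alpha i1 r).+1.
Proof.
move=> le_r; rewrite /arm (eq_card (left_arm_i r)) -addnS; congr (_ + _)%N.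
rewrite -[RHS]add1n (cardD1 i1) inE right_arm_i // eqxx; congr (_ + _)%N.
apply: eq_card => j; rewrite !inE right_arm_i //.
by case: eqP => [->|] //=; rewrite /right_arm ltnn.
Qed.

(** * Coinversions and their symmetric part *)

Lemma card_coinv (P : pred 'I_n) (x z : nat) (y : 'I_n -> nat) :
  (#|[pred j | P j && (chi3 x (y j) z != 1)]|)%:Z =
  \sum_(j | P j) (1 - chi3 x (y j) z).
Proof.
rewrite -sum1_card (big_morph Posz PoszD (erefl _)).
under eq_bigl do rewrite inE /=.
rewrite big_mkcondr; apply: eq_bigr => j _; rewrite -chi3_neq1.
by case: ifP.
Qed.

Definition cell_coinv T j r : nat :=
  (#|[pred j' | left_arm alpha j r.+1 j' &&
        (chi3 (ent T j r.+1) (ent T j' r) (ent T j r) != 1)]|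
   + #|[pred j' | right_arm alpha j r.+1 j' &&
        (chi3 (ent T j r.+1) (ent T j' r.+1) (ent T j r) != 1)]|)%N.

Lemma cell_coinvE T j r : (cell_coinv T j r)%:Z =
  \sum_(j' | left_arm alpha j r.+1 j')
     (1 - chi3 (ent T j r.+1) (ent T j' r) (ent T j r)) +
  \sum_(j' | right_arm alpha j r.+1 j')
     (1 - chi3 (ent T j r.+1) (ent T j' r.+1) (ent T j r)).
Proof. by rewrite PoszD !card_coinv. Qed.

Lemma ent_Omega_out h T j r : j != i -> j != i1 ->
  ent (Om h T) j r = ent T j r.
Proof. by move=> ji ji1; rewrite ent_Omega; case: ifP => // _; rewrite tpermD // eq_sym. Qed.

Lemma cell_coinv_Omega h T j r : j != i -> j != i1 ->
  cell_coinv (Om h T) j r = cell_coinv T j r.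
Proof.
move=> ji ji1; apply/eqP; rewrite -eqz_nat; apply/eqP; rewrite !cell_coinvE.
rewrite !ent_Omega_out //; congr (_ + _).
  under eq_bigr do rewrite ent_Omega.
  case: (r <= h)%N => //=; rewrite (reindex_inj (@perm_inj _ s)) /=.
  by apply: eq_big => [j'|j' _]; rewrite ?left_arm_tperm ?tpermK.
under eq_bigr do rewrite ent_Omega.
case: (r < h)%N => //=; rewrite (reindex_inj (@perm_inj _ s)) /=.
by apply: eq_big => [j'|j' _]; rewrite ?right_arm_tperm ?tpermK.
Qed.

(* The part of the two coinversion indicators with arm entry v that is symmetric
   in a, b and in c, d. *)
Definition sym_coinv (a b c d v : nat) : int :=
  2 - chi c v - chi d v - chi v a - chi v b.

Definition pair_sym T r : int :=
  \sum_(j | left_arm alpha i1 r.+1 j)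
    sym_coinv (ent T i r) (ent T i1 r) (ent T i r.+1) (ent T i1 r.+1) (ent T j r) +
  \sum_(j | right_arm alpha i1 r.+1 j)
    sym_coinv (ent T i r) (ent T i1 r) (ent T i r.+1) (ent T i1 r.+1) (ent T j r.+1).

Lemma arm_neq r j : left_arm alpha i1 r j || right_arm alpha i1 r j ->
  j != i /\ j != i1.
Proof.
have E : nat_of_ord i1 = i.+1 := Hi1.
move=> A; split; apply/eqP => ji; move: A; rewrite ji /left_arm /right_arm ?ltnn //=.
  by rewrite Halpha ltnn andbF E /= ltnNge leqnSn.
Qed.

Lemma pair_sym_Omega h T r : pair_sym (Om h T) r = pair_sym T r.
Proof.
have S : forall v, sym_coinv (ent (Om h T) i r) (ent (Om h T) i1 r)
    (ent (Om h T) i r.+1) (ent (Om h T) i1 r.+1) v =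
  sym_coinv (ent T i r) (ent T i1 r) (ent T i r.+1) (ent T i1 r.+1) v.
  move=> v; rewrite !ent_Omega /sym_coinv.
  by do 2 case: ifP => _; rewrite ?tpermL ?tpermR; ring.
congr (_ + _); apply: eq_bigr => j A; rewrite S ent_Omega_out //;
  by have [] := @arm_neq r.+1 j; rewrite ?A ?orbT.
Qed.

Definition row_des T r : nat :=
  ((ent T i r < ent T i r.+1) + (ent T i1 r < ent T i1 r.+1))%N.

Definition row_coinv T r : bool :=
  chi3 (ent T i r.+1) (ent T i1 r.+1) (ent T i r) != 1.

Lemma chi3_pair a b c d v :
  (1 - chi3 c v a) + (1 - chi3 d v b) =
  sym_coinv a b c d v + ((a < c) + (b < d))%N%:Z.
Proof. by rewrite PoszD /chi3 /sym_coinv /chi; case: (a < c)%N; case: (b < d)%N => /=; ring. Qed.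

Lemma cell_coinv_pair T r : (r < alpha i1)%N ->
  (cell_coinv T i r + cell_coinv T i1 r)%N%:Z =
  pair_sym T r + (arm alpha i1 r.+1 * row_des T r + row_coinv T r)%N%:Z.
Proof.
move=> lt_r; rewrite PoszD !cell_coinvE PoszD chi3_neq1.
rewrite (eq_bigl _ _ (left_arm_i r.+1)).
(* Column i1 is the only arm column not shared by the two boxes; its triple yields [row_coinv]. *)
rewrite (bigD1 (P := right_arm alpha i r.+1) i1) /=; last by rewrite right_arm_i // eqxx.
have ra_i j : right_arm alpha i r.+1 j && (j != i1) = right_arm alpha i1 r.+1 j.
  rewrite right_arm_i //; case: eqVneq => [->|] /=; last by rewrite andbT.
  by rewrite /right_arm ltnn.
rewrite (eq_bigl _ _ ra_i).
have sumE P (y : 'I_n -> nat) :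
    \sum_(j | P j) (1 - chi3 (ent T i r.+1) (y j) (ent T i r)) +
    \sum_(j | P j) (1 - chi3 (ent T i1 r.+1) (y j) (ent T i1 r)) =
    \sum_(j | P j) sym_coinv (ent T i r) (ent T i1 r) (ent T i r.+1) (ent T i1 r.+1) (y j)
    + (#|[pred j | P j]| * row_des T r)%N%:Z.
  rewrite -big_split /=; under eq_bigr do rewrite chi3_pair.
  rewrite big_split /=; congr (_ + _).
  by rewrite sumr_const pmulrn mulrzz mulrC PoszM.
have regroup (p q u v w : int) : p + (q + u) + (v + w) = (p + v) + (u + w) + q by ring.
rewrite regroup !sumE /pair_sym /arm mulnDl PoszD.
by rewrite -!addrA; congr (_ + _); rewrite addrCA !addrA.
Qed.

(** * Factorization of the weight *)

Lemma bigD_pair (R : Type) (idx : R) (op : Monoid.com_law idx) (f : 'I_n -> R) :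
  \big[op/idx]_j f j =
  op (op (f i) (f i1)) (\big[op/idx]_(j | (j != i) && (j != i1)) f j).
Proof.
by rewrite (bigD1 i) //= (bigD1 i1) /= ?Monoid.mulmA // eq_sym i_neq_i1.
Qed.

Definition other_maj T : nat :=
  (\sum_(j | (j != i) && (j != i1)) \sum_(r < alpha j)
     (if (ent T j r < ent T j r.+1)%N then (leg alpha j r.+1).+1 else 0))%N.

(** An integer, since [sym_coinv] can be negative; hence the integer power of t in [other_wt]. *)
Definition other_coinv T : int :=
  (\sum_(j | (j != i) && (j != i1)) \sum_(r < alpha j) cell_coinv T j r)%N%:Z
  + \sum_(r < alpha i1) pair_sym T r.

Definition box_factor T j r : Kqt :=
  if ent T j r.+1 != ent T j r then
    (1 - tv) / (1 - qv ^+ (leg alpha j r.+1).+1 * tv ^+ (arm alpha j r.+1).+1)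
  else 1.

Definition other_wt T : Kqt :=
  qv ^+ other_maj T * tv ^ other_coinv T *
  \prod_(j | (j != i) && (j != i1)) \prod_(r < alpha j) box_factor T j r.

Lemma other_wt_Omega h T : other_wt (Om h T) = other_wt T.
Proof.
have E1 : other_maj (Om h T) = other_maj T.
  apply: eq_bigr => j /andP[ji ji1]; apply: eq_bigr => r _.
  by rewrite !ent_Omega_out.
have E2 : other_coinv (Om h T) = other_coinv T.
  congr (Posz _ + _); last by apply: eq_bigr => r _; rewrite pair_sym_Omega.
  apply: eq_bigr => j /andP[ji ji1]; apply: eq_bigr => r _.
  by rewrite cell_coinv_Omega.
rewrite /other_wt E1 E2; congr (_ * _).
apply: eq_bigr => j /andP[ji ji1]; apply: eq_bigr => r _.
by rewrite /box_factor !ent_Omega_out.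
Qed.

Lemma majE T :
  maj T = (other_maj T + \sum_(r < alpha i1) (leg alpha i1 r.+1).+1 * row_des T r)%N.
Proof.
rewrite /maj bigD_pair /= addnC; congr (_ + _)%N.
  by apply: eq_bigr => j _; rewrite big_add1 big_mkord.
rewrite Halpha !big_add1 !big_mkord -big_split /=; apply: eq_bigr => r _.
rewrite /row_des /leg Halpha mulnDr.
by do 2 case: ifP; rewrite ?muln1 ?muln0.
Qed.

Lemma coinvE T : (coinv T)%:Z = other_coinv T +
  (\sum_(r < alpha i1) (arm alpha i1 r.+1 * row_des T r + row_coinv T r))%N%:Z.
Proof.
have -> : coinv T = (\sum_(j < n) \sum_(r < alpha j) cell_coinv T j r)%N.
  by apply: eq_bigr => j _; rewrite big_add1 big_mkord.
rewrite bigD_pair /= PoszD /other_coinv addrC -addrA; congr (_ + _).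
rewrite Halpha -big_split /= !(big_morph Posz PoszD (erefl _)) -big_split /=.
by apply: eq_bigr => r _; rewrite cell_coinv_pair.
Qed.

Definition xrow r : Kqt := qv ^+ (leg alpha i1 r.+1).+1 * tv ^+ (arm alpha i1 r.+1).

Definition wt_at T r : Kqt :=
  row_wt (xrow r) tv (ent T i r) (ent T i1 r) (ent T i r.+1) (ent T i1 r.+1).

Lemma wtE T : wt T = other_wt T * \prod_(r < alpha i1) wt_at T r.
Proof.
have -> : wt T = qv ^+ maj T * tv ^ (coinv T)%:Z *
    \prod_(j < n) \prod_(r < alpha j) box_factor T j r.
  congr (_ * _); apply: eq_bigr => j _.
  by rewrite big_mkcond big_add1 big_mkord.
rewrite bigD_pair /= majE coinvE Halpha -big_split /= exprD expfzDr ?tv_neq0 //.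
rewrite /other_wt -exprnP !expr_sum -!mulrA; congr (_ * _).
rewrite [LHS]mulrCA; congr (_ * _); rewrite [RHS]mulrC !mulrA; congr (_ * _).
rewrite -!big_split /=; apply: eq_bigr => r _.
rewrite /wt_at row_wt_monomial /box_factor /leg (arm_i (ltn_ord r)) Halpha.
reflexivity.
Qed.

Lemma xrow_neq0 r : 1 - xrow r * tv ^+ 2 != 0 /\ 1 - xrow r * tv != 0.
Proof. 
rewrite /xrow; have N := one_sub_qt_neq0 (leg alpha i1 r.+1).
by split; [have := N (arm alpha i1 r.+1 + 2)%N | have := N (arm alpha i1 r.+1 + 1)%N];
  rewrite exprD mulrA.
 Qed.

Lemma rhoE T r : (r < alpha i1)%N -> rho i i1 T r =
  row_rho (xrow r) tv (ent T i r) (ent T i1 r) (ent T i r.+1) (ent T i1 r.+1).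
Proof.
move=> lt_r; by rewrite /rho Halpha lt_r row_rho_monomial.
Qed.

Lemma rho_top T : rho i i1 T (alpha i) = 0.
Proof. by rewrite /rho ltnn. Qed.

(** If h < k, only [Om k] exchanges the entries of row k, so equality would make them coincide. Thus
    the h picked in [Pi] is unique. *)
Lemma Omega_inj T (h k : 'I_(alpha i).+1) : nonattacking T ->
  Om h T = Om k T -> h = k.
Proof.
move=> /nonattackingP[same _].
wlog hk : h k / (h <= k)%N.
  by move=> W; have [|/ltnW] := leqP h k; [exact: W | move=> L /esym E; rewrite (W _ _ L E)].
move=> E; apply: val_inj => /=; apply/eqP; rewrite eqn_leq hk leqNgt; apply/negP => lt.
have := congr1 (fun U => ent U i k) E; rewrite !ent_Omega leqnn leqNgt lt /= tpermL => /eqP.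
have lek : (k <= alpha i)%N by rewrite -ltnS.
by rewrite (negbTE (same i i1 k i_neq_i1 lek _)) // -Halpha.
Qed.

Lemma Pi_Omega T (h : 'I_(alpha i).+1) : nonattacking T ->
  Pi i i1 T (Om h T) = (\prod_(r < h) rho i i1 T r) * (1 - rho i i1 T h).
Proof.
move=> na; rewrite /Pi; case: pickP => [k /eqP/(Omega_inj na) -> //|/(_ h)].
by rewrite eqxx.
Qed.

Lemma Pi_neq0 T U : Pi i i1 T U != 0 -> exists h : 'I_(alpha i).+1, U = Om h T.
Proof. by rewrite /Pi; case: pickP => [h /eqP ->|]; [exists h | rewrite eqxx]. Qed.

Lemma has_basement_Omega sigma h T : has_basement sigma T ->
  has_basement (s * sigma)%g (Om h T).
Proof.
move=> /forallP B; apply/forallP => j.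
by rewrite ent_Omega leq0n permM (eqP (B _)).
Qed.

Lemma NA_row T r : nonattacking T -> (r < alpha i1)%N ->
  [/\ ent T i r != ent T i1 r, ent T i r.+1 != ent T i1 r.+1
    & ent T i r != ent T i1 r.+1].
Proof.
move=> /nonattackingP[same next] lt_r.
have E : nat_of_ord i1 = i.+1 := Hi1.
by split; [apply: same | apply: same | apply: next];
  rewrite ?i_neq_i1 ?Halpha ?E // ltnW.
Qed.

Lemma nonattacking_Omega T (h : 'I_(alpha i).+1) : nonattacking T ->
  (\prod_(r < h) rho i i1 T r) * (1 - rho i i1 T h) != 0 -> nonattacking (Om h T).
Proof.
move=> na; rewrite mulf_eq0 negb_or => /andP[/prodf_neq0 nz nzh].
have rho_nz r : (r < h)%N -> rho i i1 T r != 0.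
  by move=> lt_r; exact: (nz (Ordinal lt_r)).
have /nonattackingP[same next] := na.
have E : nat_of_ord i1 = i.+1 := Hi1.
have leh : (h <= alpha i1)%N by rewrite -Halpha -ltnS.
apply/nonattackingP; split=> [j j' r ne le le'|j j' r lt le lt'].
  by rewrite !ent_Omega; case: ifP => _; apply: same; rewrite ?alpha_tperm ?(inj_eq perm_inj).
rewrite !ent_Omega.
have [|jj'] := boolP ((j == i) && (j' == i1)).
  case/andP=> /eqP Ej /eqP Ej'; subst j j'; rewrite tpermL tpermR.
  have [ab cd ad] := NA_row na lt'.
  (* A new attack between (i,r) and (i1,r+1) means b = d if r = h, where 1 - rho is 0, and b = c if
     r < h, where rho is 0. *)
  case: (ltngtP r h) => rh; last 1 first.
  - apply: contraNneq nzh => bd; rewrite -rh rhoE // -bd row_rho_bd ?subrr //.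
    by rewrite eq_sym bd.
  - apply: contraNneq (rho_nz _ rh) => bc; rewrite rhoE // bc row_rho_bc // -bc //.
  - exact: next.
(* For any other pair of columns the left-right order survives the swap. *)
have lts : (s j < s j')%N && (s j < j')%N.
  move: jj' lt; rewrite -!val_eqE /=.
  by case: tpermP => [->|->|_ _]; case: tpermP => [->|->|/eqP + /eqP +];
    rewrite -?val_eqE /= ?E; lia.
have /andP[lts1 lts2] := lts.
by case: ifP => rh; case: ifP => rh'; apply: next; rewrite ?alpha_tperm //; lia.
Qed.

Lemma prob_sum1 sigma T : T \in NAF alpha sigma ->
  \sum_(U in NAF alpha (s * sigma)%g) Pi i i1 T U = 1.
Proof.
rewrite inE => /andP[bT na].
rewrite big_rmcond /=; last first.
  move=> U; apply: contraNeq => nz; have [h Uh] := Pi_neq0 nz.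
  move: nz; rewrite Uh inE Pi_Omega // => nz.
  by rewrite has_basement_Omega // nonattacking_Omega.
transitivity (\sum_(U in [set Om (val h) T | h : 'I_(alpha i).+1]) Pi i i1 T U).
  rewrite [RHS]big_rmcond //= => U; apply: contraNeq => /Pi_neq0[h ->].
  exact: imset_f.
rewrite big_imset /=; last by move=> h k _ _; exact: Omega_inj.
under eq_bigr do rewrite Pi_Omega //.
(* The top row has rho = 0, so the process surely stops. *)
by rewrite sum_stop big_ord_recr /= rho_top mulr0 subr0.
Qed.

(** * Detailed balance *)

Lemma balance_row h T r : nonattacking T -> nonattacking (Om h T) -> (r < alpha i1)%N ->
  wt_at T r * stop_factor h (rho i i1 T) r =
  wt_at (Om h T) r * stop_factor h (rho i i1 (Om h T)) r.
Proof.
move=> naT naU lt_r.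
have [ab cd ad] := NA_row naT lt_r.
have [ab' cd' ad'] := NA_row naU lt_r.
have [nz2 nz1] := xrow_neq0 r.
rewrite /stop_factor !rhoE //; move: ab' cd' ad'.
rewrite /wt_at !ent_Omega tpermL tpermR.
(* Non-attacking of the swapped filling, in [ad'], reads b != c below row h and b != d at row h. *)
case: (ltngtP r h) => rh ab' cd' ad'.
- exact (row_swap_both nz2 nz1 ab cd ad ad').
- reflexivity.
- exact (row_swap_bottom nz2 nz1 ab cd ad ad').
Qed.

Lemma balance_Omega T (h : 'I_(alpha i).+1) :
  nonattacking T -> nonattacking (Om h T) ->
  wt T * Pi i i1 T (Om h T) = wt (Om h T) * Pi i i1 (Om h T) T.
Proof.
move=> naT naU.
have leh : (h <= alpha i1)%N by rewrite -Halpha -ltnS.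
have top (U : filling) : rho i i1 U (alpha i1) = 0 by rewrite /rho Halpha ltnn.
have PU : Pi i i1 (Om h T) T =
    (\prod_(r < h) rho i i1 (Om h T) r) * (1 - rho i i1 (Om h T) h).
  by rewrite -Pi_Omega // OmegaK.
rewrite Pi_Omega // PU !(prod_stop leh) // !wtE other_wt_Omega.
rewrite -!(mulrA (other_wt T)); congr (_ * _).
rewrite -!big_split /=; apply: eq_bigr => r _; exact: balance_row.
Qed.

End Fillings.

(* columns 0-indexed: i, i1 = i+1 play the role of the paper's i, i+1;
   sigma s_i is (tperm i i1 * sigma)%g, i.e. j |-> sigma (s_i j). *)
Theorem theorem3p8 (n : nat) (alpha : 'I_n -> nat) (sigma : 'S_n)
  (i i1 : 'I_n) (Hi1 : val i1 = (val i).+1) (Halpha : alpha i = alpha i1) :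
  prob_bij (@NAF n alpha sigma) (@NAF n alpha (tperm i i1 * sigma)%g)
    (@wt n alpha) (@wt n alpha) (@Pi n alpha i i1) (@Pi n alpha i i1).
Proof.
split=> [T|U|T U].
- exact: prob_sum1.
- by move/(prob_sum1 Hi1 Halpha); rewrite mulgA tperm2 mul1g.
- rewrite !inE => /andP[_ naT] /andP[_ naU].
  have [PTU|/Pi_neq0[h Uh]] := eqVneq (Pi i i1 T U) 0%R; last first.
    by rewrite Uh; apply: balance_Omega; rewrite // -Uh.
  (* If only the reverse probability is nonzero, balance is applied from U. *)
  have [PUT|/Pi_neq0[h Th]] := eqVneq (Pi i i1 U T) 0%R.
    by rewrite PTU PUT !GRing.mulr0.
  by rewrite Th; apply/esym/balance_Omega; rewrite // -Th.
Qed.
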